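(* Let $1 < p < q < \infty$. Then $J_q$ does not coarse Lipschitz embed into $J_p$; that is, there is no map $f : J_q \to J_p$ which is a coarse Lipschitz embedding.
   Context: Here $\mathbb{N}=\{0,1,2,\dots\}$. For $1<p<\infty$, the James space $J_p$ is the (real) Banach space of all sequences $x:\mathbb{N}\to\mathbb{R}$ with $x(n)\to 0$ and $\|x\|_{J_p} = \sup_{p_1<\dots<p_n}\big(\sum_{i=1}^{n-1}|x(p_{i+1})-x(p_i)|^p\big)^{1/p}<\infty$, the supremum being over all finite increasing sequences $p_1<\dots<p_n$ in $\mathbb{N}$, equipped with the norm $\|\cdot\|_{J_p}$. A map $f:M\to N$ between metric spaces $(M,d)$ and $(N,\delta)$ is a coarse Lipschitz embedding if there exist $\theta, A, B>0$ such that for all $x,y\in M$: $d(x,y)\ge\theta \Rightarrow A\,d(x,y)\le \delta(f(x),f(y))\le B\,d(x,y)$. If such an $f$ exists, $M$ is said to coarse Lipschitz embed into $N$. Banach spaces are regarded as metric spaces via the norm distance. *)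

(* Defs.v *)
From HB Require Import structures.
From mathcomp Require Import all_boot all_order all_algebra.
From mathcomp Require Import all_classical all_reals all_analysis.
From mathcomp Require Import ring.

Set Implicit Arguments.
Unset Strict Implicit.
Unset Printing Implicit Defensive.

Import Order.TTheory GRing.Theory Num.Theory.
Import numFieldNormedType.Exports.

Local Open Scope classical_set_scope.
Local Open Scope ring_scope.

Section coarse_lipschitz.
Context {R : realType}.

Definition coarse_lipschitz_embedding (M N : metricType R) (f : M -> N) :=
  exists theta A B : R, [/\ 0 < theta, 0 < A, 0 < B &
    forall x y : M, theta <= mdist x y ->
      A * mdist x y <= mdist (f x) (f y) <= B * mdist x y].

Definition coarse_lipschitz_embeds (M N : metricType R) :=
  exists f : M -> N, coarse_lipschitz_embedding f.

End coarse_lipschitz.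

Section james_norm.
Context {R : realType}.
Implicit Types (p : R) (x y : nat -> R) (s : seq nat).

(* s lists p_1 < ... < p_n. If n <= 1, the sum is empty and the value is 0. *)
Definition james_variation p x s : R :=
  (\sum_(i < (size s).-1)
     `|x (nth 0%N s i.+1) - x (nth 0%N s i)| `^ p) `^ p^-1.

Definition james_norm p x : \bar R :=
  ereal_sup [set (james_variation p x s)%:E | s in [set s | sorted ltn s]].

Definition is_james p x : Prop :=
  (x n @[n --> \oo] --> (0 : R)) /\ (james_norm p x < +oo)%E.

End james_norm.

Section minkowski_finite.
Context {R : realType}.

Lemma powR_conv (p t x y : R) : 1 <= p -> 0 <= t <= 1 -> 0 <= x -> 0 <= y ->
  (t * x + (1 - t) * y) `^ p <= t * x `^ p + (1 - t) * y `^ p.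
Proof.
move=> p1 /andP[t0 t1] x0 y0.
have := @convex_powR R p p1 (Itv01 t0 t1) x y.
rewrite !inE /= !in_itv /= !andbT => /(_ x0 y0).
by rewrite !convRE.
Qed.

Lemma minkowski_sum (I : finType) (p : R) (a b : I -> R) : 1 <= p ->
  (forall i, 0 <= a i) -> (forall i, 0 <= b i) ->
  (\sum_i (a i + b i) `^ p) `^ p^-1 <=
  (\sum_i a i `^ p) `^ p^-1 + (\sum_i b i `^ p) `^ p^-1.
Proof.
move=> p1 a0 b0.
have p0 : 0 < p by rewrite (lt_le_trans _ p1).
have sum0 (c : I -> R) : (\sum_i c i `^ p) `^ p^-1 = 0 ->
    (forall i, 0 <= c i) -> forall i, c i = 0.
  move=> /powR_eq0_eq0 /eqP; rewrite psumr_eq0 => [|i _]; last exact: powR_ge0.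
  by move=> /allP h _ i; have /eqP/powR_eq0_eq0 := h i (mem_index_enum i).
have powP (c : I -> R) : ((\sum_i c i `^ p) `^ p^-1) `^ p = \sum_i c i `^ p.
  have c0 : 0 <= \sum_i c i `^ p by apply: sumr_ge0 => i _; exact: powR_ge0.
  rewrite -powRrM.
  rewrite mulVf.
    exact: powRr1.
  by rewrite (gt_eqF p0).
set A := (\sum_i a i `^ p) `^ p^-1; set B := (\sum_i b i `^ p) `^ p^-1.
have [A0|An0] := eqVneq A 0.
  rewrite A0 add0r /B; under eq_bigr do rewrite (sum0 _ A0 a0) add0r.
  by [].
have [B0|Bn0] := eqVneq B 0.
  rewrite B0 addr0 /A; under eq_bigr do rewrite (sum0 _ B0 b0) addr0.
  by [].
have Ap : 0 < A by rewrite lt_neqAle eq_sym An0 powR_ge0.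
have Bp : 0 < B by rewrite lt_neqAle eq_sym Bn0 powR_ge0.
have AE : A `^ p = \sum_i a i `^ p by exact: powP.
have BE : B `^ p = \sum_i b i `^ p by exact: powP.
clearbody A B.
have Sp : 0 < A + B by rewrite addr_gt0.
have normalize (c : I -> R) (C : R) : 0 < C -> (forall i, 0 <= c i) ->
    C `^ p = \sum_i c i `^ p -> \sum_i (c i / C) `^ p = 1.
  move=> C0 c0 CE.
  under eq_bigr do rewrite powRM ?invr_ge0 ?(ltW C0)//.
  rewrite -mulr_suml -CE -powRM ?invr_ge0 ?(ltW C0)// divff ?gt_eqF//.
  by rewrite powR1.
pose t := A / (A + B).
have t01 : 0 <= t <= 1.
  by rewrite /t divr_ge0 ?(ltW Ap) ?(ltW Sp)//= ler_pdivrMr// mul1r lerDl ltW.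
have tE i : (a i + b i) / (A + B) = t * (a i / A) + (1 - t) * (b i / B).
  by rewrite /t; field; rewrite !gt_eqF.
have le1 : \sum_i ((a i + b i) / (A + B)) `^ p <= 1.
  apply: (@le_trans _ _
      (\sum_i (t * (a i / A) `^ p + (1 - t) * (b i / B) `^ p))).
    apply: ler_sum => i _; rewrite tE.
    by apply: powR_conv => //; rewrite divr_ge0// ltW.
  rewrite big_split /= -!mulr_sumr (normalize a A)// (normalize b B)//.
  by rewrite !mulr1 subrKC.
have leS : \sum_i (a i + b i) `^ p <= (A + B) `^ p.
  have -> : \sum_i (a i + b i) `^ p =
      (\sum_i ((a i + b i) / (A + B)) `^ p) * (A + B) `^ p.
    rewrite mulr_suml; apply: eq_bigr => i _.
    rewrite -powRM ?divr_ge0 ?addr_ge0 ?(ltW Ap) ?(ltW Bp)//.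
    by rewrite divfK// gt_eqF.
  by apply: ler_piMl => //; exact: powR_ge0.
have -> : A + B = ((A + B) `^ p) `^ p^-1.
  by rewrite -powRrM mulfV ?(gt_eqF p0)// powRr1// ltW.
apply: ge0_ler_powR => //; rewrite ?nnegrE ?powR_ge0 ?invr_ge0 ?(ltW p0)//.
by rewrite sumr_ge0// => i _; exact: powR_ge0.
Qed.

End minkowski_finite.

Section james_norm_theory.
Context {R : realType} (p : R).
Hypothesis p1 : 1 < p.
Implicit Types (x y : nat -> R) (s : seq nat).

Let p0 : 0 < p. Proof. exact: lt_trans p1. Qed.

Lemma james_variation_ge0 x s : 0 <= james_variation p x s.
Proof. exact: powR_ge0. Qed.

Lemma james_variationD x y s :
  james_variation p (x \+ y) s <= james_variation p x s + james_variation p y s.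
Proof.
rewrite /james_variation.
have := @minkowski_sum R 'I_(size s).-1 p
  (fun i => `|x (nth 0%N s i.+1) - x (nth 0%N s i)|)
  (fun i => `|y (nth 0%N s i.+1) - y (nth 0%N s i)|)
  (ltW p1) (fun=> normr_ge0 _) (fun=> normr_ge0 _).
apply: le_trans.
apply: ge0_ler_powR; rewrite ?invr_ge0 ?(ltW p0)//.
- by rewrite nnegrE sumr_ge0// => i _; exact: powR_ge0.
- by rewrite nnegrE sumr_ge0// => i _; exact: powR_ge0.
apply: ler_sum => i _; apply: ge0_ler_powR; rewrite ?(ltW p0) ?nnegrE//.
by apply: le_trans (ler_normD _ _); rewrite /= opprD addrACA.
Qed.

Lemma james_variationZ (a : R) x s :
  james_variation p (fun n => a * x n) s = `|a| * james_variation p x s.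
Proof.
rewrite /james_variation.
under eq_bigr do rewrite -mulrBr normrM powRM//.
rewrite -mulr_sumr powRM ?powR_ge0//; last first.
  by apply: sumr_ge0 => i _; exact: powR_ge0.
by rewrite -powRrM mulfV ?gt_eqF// powRr1.
Qed.

Lemma james_variation2 x m n : james_variation p x [:: m; n] = `|x n - x m|.
Proof.
rewrite /james_variation big_ord_recl big_ord0 addr0 /= -powRrM.
by rewrite mulfV ?gt_eqF// powRr1.
Qed.

Lemma james_variation_bound x s (d : R) : 0 <= d ->
  (forall i, `|x (nth 0%N s i)| <= d) ->
  james_variation p x s <= (size s)%:R `^ p^-1 * (d + d).
Proof.
move=> d0 xd; have dd0 : 0 <= d + d by rewrite addr_ge0.
apply: (@le_trans _ _ (((size s)%:R * (d + d) `^ p) `^ p^-1)).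
  apply: ge0_ler_powR; rewrite ?invr_ge0 ?(ltW p0) ?nnegrE//.
  - by rewrite sumr_ge0// => i _; exact: powR_ge0.
  - by rewrite mulr_ge0// powR_ge0.
  apply: (@le_trans _ _ (\sum_(i < (size s).-1) (d + d) `^ p)).
    apply: ler_sum => i _; apply: ge0_ler_powR; rewrite ?(ltW p0) ?nnegrE//.
    by rewrite (le_trans (ler_normB _ _))// lerD.
  rewrite sumr_const card_ord -[leLHS]mulr_natl ler_wpM2r ?powR_ge0//.
  by rewrite ler_nat leq_pred.
rewrite powRM ?powR_ge0// -[((d + d) `^ p) `^ _]powRrM.
by rewrite mulfV ?gt_eqF// powRr1.
Qed.

Lemma james_variation_le x s : sorted ltn s ->
  ((james_variation p x s)%:E <= james_norm p x)%E.
Proof. by move=> ss; apply: ereal_sup_ubound; exists s. Qed.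

Lemma james_norm_le x (M : \bar R) :
  (forall s, sorted ltn s -> ((james_variation p x s)%:E <= M)%E) ->
  (james_norm p x <= M)%E.
Proof. by move=> h; apply: ge_ereal_sup => _ [s /= ss <-]; exact: h. Qed.

Lemma james_norm_ge0 x : (0 <= james_norm p x)%E.
Proof.
apply: le_trans (@james_variation_le x [::] isT).
by rewrite lee_fin james_variation_ge0.
Qed.

Lemma james_normD x y :
  (james_norm p (x \+ y)%R <= james_norm p x + james_norm p y)%E.
Proof.
apply: james_norm_le => s ss.
apply: (le_trans _ (leeD (james_variation_le x ss) (james_variation_le y ss))).
by rewrite -EFinD lee_fin james_variationD.
Qed.

Lemma james_norm_fin x : (james_norm p x < +oo)%E ->
  james_norm p x \is a fin_num.
Proof. by move=> h; rewrite ge0_fin_numE// james_norm_ge0. Qed.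

Lemma james_normZ (a : R) x : (james_norm p x < +oo)%E ->
  james_norm p (fun n => a * x n) = (`|a|%:E * james_norm p x)%E.
Proof.
move=> xoo; have le b y : (james_norm p y < +oo)%E ->
    (james_norm p (fun n => b * y n)%R <= `|b|%:E * james_norm p y)%E.
  move=> yoo; apply: james_norm_le => s ss.
  by rewrite james_variationZ EFinM lee_wpmul2l// james_variation_le.
apply/eqP; rewrite eq_le le//=.
have [->|a0] := eqVneq a 0; first by rewrite normr0 mul0e james_norm_ge0.
have axoo : (james_norm p (fun n => a * x n)%R < +oo)%E.
  apply: le_lt_trans (le a x xoo) _.
  by rewrite lte_mul_pinfty// lee_fin.
have := le a^-1 _ axoo; under [X in james_norm p X]eq_fun do rewrite mulKf//.
rewrite -(fineK (james_norm_fin axoo)) -(fineK (james_norm_fin xoo)).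
rewrite -!EFinM !lee_fin normfV => h.
by rewrite mulrC -ler_pdivlMr ?normr_gt0// mulrC.
Qed.

(* The proof that 1 < p is a parameter because the closure properties, hence the
   instances below, depend on it. *)
Definition james_pred (_ : 1 < p) : {pred nat -> R} :=
  [pred x | `[< is_james p x >]].

Lemma james_predP x : reflect (is_james p x) (x \in james_pred p1).
Proof. exact: asboolP. Qed.

Lemma is_james0 : is_james p (fun=> 0).
Proof.
split; first exact: cvg_cst.
apply: (@le_lt_trans _ _ 0%E); last exact: ltry.
apply: james_norm_le => s _; rewrite lee_fin /james_variation.
under eq_bigr do rewrite subrr normr0 powR0 ?gt_eqF//.
by rewrite big1// powR0// invr_eq0 gt_eqF.
Qed.

Lemma is_jamesZ (a : R) x : is_james p x -> is_james p (fun n => a * x n).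
Proof.
move=> [x0 xoo]; split.
  rewrite -[X in _ --> X](mulr0 a).
  by apply: cvgM => //; exact: cvg_cst.
rewrite (james_normZ a xoo).
by apply: lte_mul_pinfty xoo => //; rewrite lee_fin.
Qed.

Lemma is_jamesD x y : is_james p x -> is_james p y -> is_james p (x \+ y).
Proof.
move=> [x0 xoo] [y0 yoo]; split.
  by rewrite -[X in _ --> X](addr0 (0 : R)); exact: cvgD.
apply: (@le_lt_trans _ _ (james_norm p x + james_norm p y)%E).
  exact: james_normD.
exact: lte_add_pinfty xoo yoo.
Qed.

Lemma james_submod_closed : submod_closed (james_pred p1).
Proof.
split; first by apply/james_predP; exact: is_james0.
move=> a x y /james_predP xJ /james_predP yJ; apply/james_predP.
exact: (is_jamesD (is_jamesZ a xJ) yJ).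
Qed.

HB.instance Definition _ := GRing.isSubmodClosed.Build R (nat -> R)
  (james_pred p1) james_submod_closed.

Lemma ler_james_norm x n : is_james p x -> (`|x n|%:E <= james_norm p x)%E.
Proof.
move=> [x0 xoo]; rewrite -(fineK (james_norm_fin xoo)) lee_fin.
have xn : (x n - x m @[m --> \oo] --> x n).
  rewrite -[X in _ --> X](subr0 (x n)).
  by apply: cvgB => //; exact: cvg_cst.
have {}xn : (`|x n - x m| @[m --> \oo] --> `|x n|) by exact: cvg_norm.
rewrite -(cvg_lim (@Rhausdorff R) xn).
apply: limr_le; first by apply/cvg_ex; exists `|x n|.
near=> m.
rewrite -lee_fin (fineK (james_norm_fin xoo)) distrC -james_variation2.
apply: james_variation_le => /=; rewrite andbT.
by near: m; exact: nbhs_infty_gt.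
Unshelve. all: by end_near. Qed.

End james_norm_theory.

Record james (R : realType) (p : R) (p1 : 1 < p) := James {
  james_val :> nat -> R;
  james_valP : james_val \in james_pred p1 }.

Section james_space.
Context {R : realType} (p : R) (p1 : 1 < p).
Local Notation J := (james p1).
Implicit Types x y : J.

HB.instance Definition _ := [isSub for @james_val R p p1].
HB.instance Definition _ := [Choice of J by <:].
HB.instance Definition _ := [SubChoice_isSubLmodule of J by <:].

Lemma jamesP x : is_james p x.
Proof. exact/james_predP/james_valP. Qed.

Let norm x : R := fine (james_norm p x).

Let norm_fin x : james_norm p x \is a fin_num.
Proof. exact: (james_norm_fin (jamesP x).2). Qed.

Let fineD (a b c : \bar R) : a \is a fin_num -> b \is a fin_num ->
  (c <= a + b)%E -> c \is a fin_num -> fine c <= fine a + fine b.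
Proof.
by move=> fa fb cab fc; rewrite -fineD// fine_le// fin_numD fa.
Qed.

Let valD x y : james_val (x + y) = james_val x \+ james_val y.
Proof. by []. Qed.

Let ler_normD x y : norm (x + y) <= norm x + norm y.
Proof.
apply: (fineD (norm_fin x) (norm_fin y) _ (norm_fin (x + y))).
rewrite valD.
exact: (james_normD p1 x y).
Qed.

Let valZ a x : james_val (a *: x) = (fun n => a * x n).
Proof. by []. Qed.

Let normrZ (a : R) x : norm (a *: x) = `|a| * norm x.
Proof.
by rewrite /norm valZ (james_normZ p1 a (jamesP x).2) fineM.
Qed.

Let normr0_eq0 x : norm x = 0 -> x = 0.
Proof.
move=> x0; apply: val_inj; apply/funext => n /=; apply/eqP.
have := ler_james_norm p1 n (jamesP x).
by rewrite -(fineK (norm_fin x)) lee_fin -/(norm x) x0 normr_le0.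
Qed.

HB.instance Definition _ :=
  Lmodule_isNormed.Build R J ler_normD normrZ normr0_eq0.

Lemma james_normE x : `|x| = fine (james_norm p x).
Proof. by []. Qed.

Let dist x y : R := `|x - y|.

Let dist_ge0 x y : 0 <= dist x y.
Proof. exact: normr_ge0. Qed.

Let dist_positivity x y : dist x y = 0 -> x = y.
Proof. by move=> /normr0_eq0/eqP; rewrite subr_eq0 => /eqP. Qed.

Let ballE x d : ball x d = [set y | dist x y < d].
Proof. by rewrite -ball_normE. Qed.

HB.instance Definition _ :=
  @PseudoMetric_isMetric.Build R J dist dist_ge0 dist_positivity ballE.

Lemma james_mdistE x y : mdist x y = `|x - y|.
Proof. by rewrite /mdist /=; reflexivity. Qed.

Lemma james_valB x y n : (x - y) n = x n - y n.
Proof. by []. Qed.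

Lemma ler_james x n : `|x n| <= `|x|.
Proof.
rewrite james_normE -lee_fin fineK.
  exact: ler_james_norm (jamesP x).
exact: james_norm_fin (jamesP x).2.
Qed.

Lemma ler_james_variation x s : sorted ltn s -> james_variation p x s <= `|x|.
Proof.
move=> ss; rewrite james_normE -lee_fin fineK.
  exact: james_variation_le.
exact: james_norm_fin (jamesP x).2.
Qed.

(* A pointwise limit l of a Cauchy filter F is in J, at distance at most e from
   every x that is F-eventually at distance at most e. *)
Lemma james_lim_near (F : set_system J) (l : nat -> R) x (e : R) :
  ProperFilter F -> (forall n, ((fun y : J => y n) @ F --> l n)) ->
  (\forall y \near F, `|x - y| <= e) ->
  (james_norm p (fun n => (x n - l n)%R) <= e%:E)%E.
Proof.
move=> FF Fl Fe; apply: james_norm_le => s ss; rewrite lee_fin.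
apply/ler_addgt0Pr => d d0.
pose k := (size s)%:R `^ p^-1 : R.
have k0 : 0 <= k by exact: powR_ge0.
pose c := k * 2 + 1.
have c0 : 0 < c by rewrite ltr_wpDl// mulr_ge0.
have dc0 : 0 < d / c by rewrite divr_gt0.
have Fs : \forall y \near F, forall i : 'I_(size s).+1,
    `|l (nth 0%N s i) - james_val y (nth 0%N s i)| <= d / c.
  by apply: filter_forall => i; move/cvgrPdist_le : (Fl (nth 0%N s i)); exact.
have [y [ye ys]] := filter_ex (filterI Fe Fs).
have -> : (fun n => x n - l n) = (x - y : J) \+ (fun n => y n - l n).
  by apply/funext => n; rewrite [RHS]/= subrKA.
apply: (le_trans (james_variationD p1 _ _ _)); apply: lerD.
  exact: le_trans (ler_james_variation _ ss) ye.
have bnd i : `|y (nth 0%N s i) - l (nth 0%N s i)| <= d / c.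
  rewrite distrC; have [si|si] := ltnP i (size s).+1.
    exact: (ys (Ordinal si)).
  have := ys ord_max; rewrite !nth_default//=.
  by rewrite ltnW.
apply: (le_trans (@james_variation_bound _ _ p1 (fun n => y n - l n) _ _
  (ltW dc0) bnd)).
have -> : (size s)%:R `^ p^-1 * (d / c + d / c) = d * (k * 2) / c.
  by rewrite -/k; ring.
by rewrite ler_pdivrMr// ler_wpM2l ?(ltW d0)// lerDl.
Qed.

Let cauchy_cvg (F : set_system J) : ProperFilter F -> cauchy F -> cvg F.
Proof.
move=> FF /cauchy_ballP Fc.
have near_pair (e : R) : 0 < e ->
    exists x : J, \forall y \near F, `|x - y| <= e.
  move=> e0; have /cauchyP/(_ e e0)[x Fx] : cauchy F by exact/cauchy_ballP.
  exists x; apply: filterS Fx => y; rewrite -ball_normE /= => /ltW; exact.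
have Fcvg n : cvg ((fun y : J => y n) @ F).
  apply: R_complete; apply/cauchy_exP => e e0.
  have [x Fx] := near_pair _ (divr_gt0 e0 (ltr0n R 2)).
  exists (x n); apply: filterS Fx => y /= xy.
  rewrite /ball /=; apply: le_lt_trans (le_trans (ler_james (x - y) n) xy) _.
  by rewrite ltr_pdivrMr// ltr_pMr// ltr1n.
pose l n : R := lim ((fun y : J => y n) @ F).
have Fl n : ((fun y : J => y n) @ F --> l n) by exact: Fcvg.
have xl (e : R) : 0 < e -> exists x : J,
    (\forall y \near F, `|x - y| <= e) /\
    (james_norm p (fun n => (x n - l n)%R) <= e%:E)%E.
  move=> e0; have [x Fx] := near_pair _ e0; exists x; split => //.
  exact: james_lim_near Fx.
have l0 : (l n @[n --> \oo] --> (0 : R)).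
  apply/cvgr0Pnorm_le => e e0.
  have e2 : 0 < e / 2 by rewrite divr_gt0.
  have [x Fx] := near_pair _ e2.
  have /cvgr0Pnorm_le/(_ _ e2) x0 := (jamesP x).1.
  apply: filterS x0 => n xn.
  have xln : `|x n - l n| <= e / 2.
    have h : ((fun y : J => `|x n - y n|) @ F --> `|x n - l n|).
      by apply: cvg_norm; apply: cvgB => //; exact: cvg_cst.
    rewrite -(cvg_lim (@Rhausdorff R) h).
    apply: limr_le; first by apply/cvg_ex; exists `|x n - l n|.
    by apply: filterS Fx => y; apply: le_trans; exact: (ler_james (x - y) n).
  have -> : l n = x n - (x n - l n) by rewrite subKr.
  by rewrite [leRHS]splitr (le_trans (ler_normB _ _))// lerD.
have lJ : is_james p l.
  split => //; have [x [_ xle]] := xl 1 ltr01.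
  have -> : l = x \+ (fun n => -1 * (x n - l n)).
    by apply/funext => n /=; rewrite mulN1r opprB addrC subrK.
  apply: (le_lt_trans (james_normD p1 _ _)); apply: lte_add_pinfty.
    exact: (jamesP x).2.
  have xoo := le_lt_trans xle (ltry 1).
  by rewrite (james_normZ p1 _ xoo) normrN1 mul1e.
have lP : l \in james_pred p1 by exact/james_predP.
apply/cvg_ex; exists (James lP).
apply/cvgrPdist_le => e e0.
have e2 : 0 < e / 2 by rewrite divr_gt0.
have [x [Fx xle]] := xl _ e2.
have xL : `|x - James lP| <= e / 2.
  rewrite james_normE -lee_fin fineK; first exact: xle.
  exact: james_norm_fin (jamesP (x - James lP)).2.
apply: filterS Fx => y xy.
have -> : James lP - y = (x - y) - (x - James lP).
  by rewrite opprB [RHS]addrC subrKA.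
rewrite [leRHS]splitr; apply: le_trans (lerD xy xL); exact: ler_normB.
Qed.

HB.instance Definition _ := Uniform_isComplete.Build J cauchy_cvg.

End james_space.

(* Main.v *)
(* Approximate midpoints. If f : J_q -> J_p is coarse Lipschitz, then looking at
   its asymptotic Lipschitz constant yields pairs x, y arbitrarily far apart such
   that f maps d-approximate midpoints of x, y to 6d-approximate midpoints of
   f x, f y. In J_q the approximate midpoints contain an infinite set separated
   by a multiple of d^(1/q) |x - y|: add to (x + y)/2 blocks of many tiny spikes
   supported far away. In J_p they lie within a multiple of d^(1/p) |f x - f y|
   of a bounded set of a finite-dimensional space, since the variation of a
   midpoint far away must be small; by the pigeonhole principle two of the image
   points are that close. As p < q, this is impossible for small d. *)
Require Import Defs.
From mathcomp Require Import all_boot all_order all_algebra.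
From mathcomp Require Import all_classical all_reals all_analysis.
From mathcomp Require Import zify ring lra.

Set Implicit Arguments.
Unset Strict Implicit.
Unset Printing Implicit Defensive.

Import Order.TTheory GRing.Theory Num.Theory.
Import numFieldNormedType.Exports.

Local Open Scope ring_scope.

(** * Inequalities for real powers *)

Section powR_extra.
Context {R : realType}.
Implicit Types a b p x : R.

Lemma powR_le p a b : 0 < p -> 0 <= a -> a <= b -> a `^ p <= b `^ p.
Proof.
move=> p0 a0 ab; apply: ge0_ler_powR => //; first exact: ltW.
by rewrite nnegrE (le_trans a0).
Qed.

Lemma powRVK p a : 0 < p -> 0 <= a -> (a `^ p^-1) `^ p = a.
Proof. by move=> p0 a0; rewrite -powRrM mulVf ?gt_eqF// powRr1. Qed.

Lemma powRKV p a : 0 < p -> 0 <= a -> (a `^ p) `^ p^-1 = a.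
Proof. by move=> p0 a0; rewrite -powRrM mulfV ?gt_eqF// powRr1. Qed.

Lemma ler_powRV p a b : 0 < p -> 0 <= a -> 0 <= b ->
  (a `^ p^-1 <= b) = (a <= b `^ p).
Proof.
move=> p0 a0 b0; apply/idP/idP => h.
- rewrite -(powRVK p0 a0); apply: ge0_ler_powR => //; rewrite ?nnegrE ?powR_ge0//.
  exact: ltW.
- rewrite -(powRKV p0 b0); apply: ge0_ler_powR => //; rewrite ?nnegrE ?powR_ge0//.
  by rewrite invr_ge0 ltW.
Qed.

(** Minkowski's inequality for the vectors (a, 0) and (0, b). *)
Lemma powR_superadditive p a b : 1 <= p -> 0 <= a -> 0 <= b ->
  a `^ p + b `^ p <= (a + b) `^ p.
Proof.
move=> p1 a0 b0.
have p0 : 0 < p by exact: lt_le_trans p1.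
rewrite -ler_powRV ?addr_ge0 ?powR_ge0//.
have := @minkowski_sum R bool p (fun i => if i then a else 0)
  (fun i => if i then 0 else b) p1.
rewrite !big_bool /= powR0 ?gt_eqF// !addr0 !add0r !powRKV//.
by apply => -[].
Qed.

Lemma powR_add_ge p a b : 1 <= p -> 1 <= a -> 0 <= b ->
  a `^ p + b <= (a + b) `^ p.
Proof.
move=> p1 a1 b0.
have p0 : 0 < p by exact: lt_le_trans p1.
have a0 : 0 <= a by exact: le_trans a1.
have ab0 : 0 <= a + b by exact: addr_ge0.
rewrite -(mulr_powRB1 a0 p0) -(mulr_powRB1 ab0 p0).
have abp : a `^ (p - 1) <= (a + b) `^ (p - 1).
  by apply: ge0_ler_powR; rewrite ?nnegrE ?subr_ge0// lerDl.
apply: le_trans (ler_wpM2l ab0 abp); rewrite mulrDl lerD2l.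
rewrite -[leLHS]mulr1 ler_wpM2l//.
by rewrite -[leLHS](powRr0 a) ler_powR// subr_ge0.
Qed.

(** As x <= 1, passing to the integer exponent n can only decrease the power; for x^n the bound is
    Bernoulli's inequality, by induction. *)
Lemma powR_bernoulli p (n : nat) x : 0 < p -> p <= n%:R -> 0 <= x <= 1 ->
  1 - n%:R * (1 - x) <= x `^ p.
Proof.
move=> p0 pn /andP[x0 x1].
have [->|xn0] := eqVneq x 0.
  rewrite subr0 mulr1 (le_trans _ (powR_ge0 _ _))// subr_le0 ler1n lt0n.
  by apply: contraTN pn => /eqP ->; rewrite -ltNge.
have xgt0 : 0 < x by rewrite lt_neqAle eq_sym xn0.
apply: (@le_trans _ _ (x `^ n%:R)); last by rewrite ger_powR// xgt0.
rewrite powR_mulrn// {pn}.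
elim: n => [|n IH]; first by rewrite mul0r subr0 expr0.
rewrite exprS -natr1.
have xn1 : x ^+ n <= 1 by rewrite exprn_ile1.
by nra.
Qed.

End powR_extra.

(** * The p-variation along a path and its relation to the James norm *)

Section variation.
Context {R : realType} (p : R).
Hypothesis p1 : 1 < p.
Implicit Types (x y : nat -> R) (a b : nat) (s t : seq nat).

Let p0 : 0 < p. Proof. exact: lt_trans p1. Qed.

(* The sum of [james_variation] along [a :: s], before taking the root. *)
Fixpoint pvar x a s : R :=
  if s is b :: t then `|x b - x a| `^ p + pvar x b t else 0.

Lemma pvar_ge0 x a s : 0 <= pvar x a s.
Proof. by elim: s a => //= b s IH a; rewrite addr_ge0 ?powR_ge0. Qed.

Lemma pvar_cat x a s t : pvar x a (s ++ t) = pvar x a s + pvar x (last a s) t.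
Proof. by elim: s a => [|b s IH] a /=; rewrite ?add0r// IH addrA. Qed.

Lemma eq_pvar x y a s : {in a :: s, x =1 y} -> pvar x a s = pvar y a s.
Proof.
elim: s a => //= b s IH a xy; rewrite !xy ?inE ?eqxx ?orbT//.
by rewrite (IH b)// => n ns; rewrite xy// inE ns orbT.
Qed.

Lemma pvar0 a s : pvar (fun=> 0) a s = 0.
Proof. by elim: s a => //= b s IH a; rewrite IH subrr normr0 powR0 ?gt_eqF// addr0. Qed.

Lemma james_variationE x a s : james_variation p x (a :: s) = pvar x a s `^ p^-1.
Proof.
rewrite /james_variation; congr (_ `^ _) => /=.
elim: s a => [|b s IH] a; first by rewrite big_ord0.
by rewrite big_ord_recl /= -IH.
Qed.

Lemma james_variationK x a s : james_variation p x (a :: s) `^ p = pvar x a s.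
Proof. by rewrite james_variationE powRVK// pvar_ge0. Qed.

Lemma james_variation_leE x a s (M : R) : 0 <= M ->
  (james_variation p x (a :: s) <= M) = (pvar x a s <= M `^ p).
Proof. by move=> M0; rewrite james_variationE ler_powRV// pvar_ge0. Qed.

Lemma james_variationN x s : james_variation p (fun n => - x n) s = james_variation p x s.
Proof.
have := james_variationZ p1 (-1) x s; rewrite normrN1 mul1r => <-.
by congr james_variation; apply/funext => n; rewrite mulN1r.
Qed.

Lemma sorted_split N s : sorted ltn s -> exists s1 s2,
  [/\ s = s1 ++ s2, {in s1, forall n, (n <= N)%N} & {in s2, forall n, (N < n)%N}].
Proof.
elim: s => [|a s IH] //= sa; first by exists [::], [::].
have [s1 [s2 [E h1 h2]]] := IH (path_sorted sa).
have [aN|Na] := leqP a N.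
  exists (a :: s1), s2; split => //; first by rewrite E.
  by move=> n; rewrite inE => /orP[/eqP->//|/h1].
exists [::], (a :: s); split => // n; rewrite inE => /orP[/eqP->//|ns].
move: sa; rewrite (path_sortedE ltn_trans) => /andP[/allP/(_ _ ns) an _].
exact: ltn_trans an.
Qed.

Lemma is_james_finite_support x (N : nat) (K : R) : 0 <= K -> (forall n, (N <= n)%N -> x n = 0) ->
  (forall a s, path ltn a s -> pvar x a s <= K `^ p) -> is_james p x.
Proof.
move=> K0 xN xK; split.
  apply: cvg_near_cst; near=> n; apply: xN; near: n; exact: nbhs_infty_ge.
apply: le_lt_trans (ltry K); apply: james_norm_le => -[|a s] ss; rewrite lee_fin.
  by rewrite /james_variation big_ord0 powR0// invr_neq0 ?gt_eqF.
by rewrite james_variation_leE// xK.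
Unshelve. all: by end_near. Qed.

Lemma pvar_le (x : james p1) a s : path ltn a s -> pvar x a s <= `|x| `^ p.
Proof. by move=> sa; rewrite -james_variation_leE// ler_james_variation. Qed.

Lemma james_norm_le_pvar (x : james p1) (K : R) : 0 <= K ->
  (forall a s, path ltn a s -> pvar x a s <= K `^ p) -> `|x| <= K.
Proof.
move=> K0 xK; rewrite james_normE -lee_fin fineK; last first.
  exact: james_norm_fin (jamesP x).2.
apply: james_norm_le => -[|a s] ss; rewrite lee_fin.
  by rewrite /james_variation big_ord0 powR0// invr_neq0 ?gt_eqF.
by rewrite james_variation_leE// xK.
Qed.

Lemma james_norm_lt_pvar (x : james p1) (K : R) : 0 <= K -> K < `|x| ->
  exists a s, path ltn a s /\ K `^ p < pvar x a s.
Proof.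
move=> K0 Kx; apply: contrapT => h; move: Kx; apply/negP; rewrite -leNgt.
apply: james_norm_le_pvar => // a s sa; rewrite leNgt; apply/negP => Kh.
by apply: h; exists a, s.
Qed.

End variation.

(** * Approximate midpoints in the target cluster near a finite-dimensional bounded set *)

Section midpoint_target.
Context {R : realType}.

(** The cube [-b, b]^(N+1) is cut into finitely many cells of side [e]. [G] codes the cell of a
    vector and is applied to one more index than there are codes. *)
Lemma pigeonhole_bounded (N : nat) (b e : R) (w : nat -> nat -> R) : 0 < e ->
  (forall j n, `|w j n| <= b) ->
  exists i j, i != j /\ forall n, (n <= N)%N -> `|w i n - w j n| <= e.
Proof.
move=> e0 wb.
pose g j n := Num.truncn ((w j n + b) / e).
pose L := Num.truncn ((b + b) / e).
have ge0 j n : 0 <= (w j n + b) / e.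
  by rewrite divr_ge0 ?(ltW e0)// -lerBlDr sub0r; have := wb j n; rewrite ler_norml => /andP[].
have gL j n : (g j n < L.+1)%N.
  rewrite ltnS; apply: le_truncn; rewrite ler_pM2r ?invr_gt0// lerD2r.
  exact: le_trans (ler_norm _) (wb j n).
pose G (j : 'I_#|{ffun 'I_N.+1 -> 'I_L.+1}|.+1) :=
  [ffun n : 'I_N.+1 => Ordinal (gL j n)].
have : ~~ injectiveb G.
  apply/negP => /injectiveP /leq_card; rewrite card_ord ltnn//.
case/injectivePn => i [j ij Gij]; exists (i : nat), (j : nat); split.
  by apply: contra ij => /eqP/val_inj ->.
move=> n nN; have nN' : (n < N.+1)%N by [].
have gE : g i n = g j n.
  by have /ffunP/(_ (Ordinal nN')) := Gij; rewrite !ffunE => /(congr1 val).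
have /andP[i1 i2] := truncn_itv (ge0 i n).
have /andP[j1 j2] := truncn_itv (ge0 j n).
rewrite -/(g _ _) in i1 i2 j1 j2; rewrite gE in i1 i2.
rewrite -natr1 in i2 j2.
have -> : w i n - w j n = ((w i n + b) / e - (w j n + b) / e) * e.
  by field; rewrite gt_eqF.
rewrite normrM (gtr0_norm e0) ler_piMl ?(ltW e0)// ler_norml.
by apply/andP; split; lra.
Qed.

Let balanced_ge (e D A B : R) : 0 < e -> 0 < D -> A <= (1 + e) * D ->
  (1 - e) * D * 2 <= A + B -> (1 - 4 * e) * ((1 + e) * D) <= B.
Proof. by move=> e0 D0 h1 h2; nra. Qed.

Context (p : R) (p1 : 1 < p).
Let p0 : 0 < p. Proof. exact: lt_trans p1. Qed.
Let p1' : 1 <= p. Proof. exact: ltW. Qed.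

(** Take a path that nearly norms v. As v is the mean of v + w and v - w, whose norms barely exceed
    that of v, both nearly exhaust their norm bound on this path, so little variation is left after
    its last point. The tail of w is half the difference of theirs. The path is chosen before w, so
    one N serves all midpoints. *)
Lemma tail_midpoint (n : nat) (v : james p1) (e : R) : p <= n%:R -> v != 0 ->
  0 < e -> 4 * e <= 1 ->
  exists N, forall w : james p1,
    `|v + w| <= (1 + e) * `|v| -> `|v - w| <= (1 + e) * `|v| ->
  forall s, path ltn N s ->
    james_variation p w (N :: s) <= (n%:R * (4 * e)) `^ p^-1 * ((1 + e) * `|v|).
Proof.
move=> pn v0 e0 e4.
have D0 : 0 < `|v| by rewrite normr_gt0.
have [e1 e10 e1' e40 e41] : [/\ 0 <= 1 - e, 1 - e < 1, 0 <= 1 + e,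
    0 <= 1 - 4 * e & 1 - 4 * e <= 1] by split; lra.
have [||a [s [sa]]] := @james_norm_lt_pvar _ _ p1 v ((1 - e) * `|v|).
- by rewrite mulr_ge0.
- by rewrite gtr_pMl.
rewrite ltNge => hs; exists (last a s) => w wp wm t ts.
set V := fun x : nat -> R => james_variation p x (a :: s).
have Vv : (1 - e) * `|v| <= V v.
  rewrite leNgt; apply: contraNN hs => /ltW; rewrite james_variation_leE//.
  by rewrite mulr_ge0.
set K := (1 + e) * `|v| in wp wm *.
have K0 : 0 <= K by rewrite mulr_ge0.
have VK x : V x = james_variation p x (a :: s) by [].
have V2 : (1 - e) * `|v| * 2 <= V (v + w : james p1) + V (v - w : james p1).
  have := james_variationD p1 (v + w : james p1) (v - w : james p1) (a :: s).
  have -> : (v + w : james p1) \+ (v - w : james p1) = fun n => 2 * v n.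
    by apply/funext => k; change (v k + w k + (v k - w k) = 2 * v k); ring.
  rewrite james_variationZ// -!VK gtr0_norm// => h.
  by apply: le_trans h; rewrite mulrC ler_wpM2l.
have VpK (x : james p1) : `|x| <= K -> V x <= K.
  by move=> /(le_trans _); apply; exact: ler_james_variation.
(* Each value is at least 2(1 - e) - (1 + e) = 1 - 3e times the norm of v, and (1 - 4e)(1 + e) <= 1
   - 3e. *)
have lo : (1 - 4 * e) * K <= V (v + w : james p1) /\ (1 - 4 * e) * K <= V (v - w : james p1).
  split; last exact: (balanced_ge e0 D0 (VpK _ wp) V2).
  rewrite [leRHS]addrC in V2.
  exact: (balanced_ge e0 D0 (VpK _ wm) V2).
set tau := (_ `^ _) * K.
have tau0 : 0 <= tau by rewrite mulr_ge0// powR_ge0.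
have tail (x : james p1) : `|x| <= K -> (1 - 4 * e) * K <= V x ->
    james_variation p x (last a s :: t) <= tau.
  move=> xK Vx; rewrite james_variation_leE// powRM ?powR_ge0// powRVK//; last first.
    by rewrite !mulr_ge0// ltW.
  have : pvar p x a (s ++ t) <= K `^ p.
    apply: le_trans (@pvar_le _ _ p1 x a (s ++ t) _) _; first by rewrite cat_path sa.
    exact: (powR_le p0 (normr_ge0 x) xK).
  rewrite pvar_cat -(james_variationK p1 _ a s) => h.
  have h1 : ((1 - 4 * e) * K) `^ p <= V x `^ p.
    exact: powR_le p0 (mulr_ge0 e40 K0) Vx.
  (* By Bernoulli the path uses up all but at most a fraction 4ne of K^p; that fraction bounds the
     tail. *)
  have := @powR_bernoulli _ p n (1 - 4 * e) p0 pn; rewrite e40 e41 => /(_ isT) h2.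
  rewrite powRM// -/(V x) in h1 *.
  have KP : 0 <= K `^ p by exact: powR_ge0.
  rewrite -/(V x) in h.
  have := le_trans (ler_wpM2r KP h2) h1.
  by rewrite subKr mulrBl mul1r lerBlDr => /(le_trans h); rewrite lerD2l.
have := james_variationD p1 (v + w : james p1) (fun n => - (v - w : james p1) n) (last a s :: t).
have -> : (v + w : james p1) \+ (fun n => - (v - w : james p1) n) = fun n => 2 * w n.
  by apply/funext => k; change (v k + w k + - (v k - w k) = 2 * w k); ring.
rewrite james_variationZ// james_variationN// gtr0_norm//.
move=> /le_trans/(_ (lerD (tail _ wp lo.1) (tail _ wm lo.2))).
by rewrite -mulr2n -(mulr_natl tau) ler_pM2l.
Qed.

(** A path is cut at N into a head with few points and small values, a tail covered by hypothesis,
    and the jump between them. They contribute at most t, t and 2t, and superadditivity of the p-th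
    power combines these. *)
Lemma james_norm_small_head (d : james p1) (N : nat) (e t : R) : 0 <= e -> 0 <= t ->
  (N.+2)%:R `^ p^-1 * (e + e) <= t -> 
  (forall n, (n <= N)%N -> `|d n| <= e) ->
  (forall s, path ltn N s -> james_variation p d (N :: s) <= t) ->
  `|d| <= 5 * t.
Proof.
move=> e0 t0 et hd tl; apply: james_norm_le_pvar; first by rewrite mulr_ge0.
have Nt a s : path ltn N (a :: s) -> pvar p d a s <= t `^ p.
  move=> h; have := tl _ h; rewrite james_variation_leE// /=; apply: le_trans.
  by rewrite lerDr powR_ge0.
have tw (k : R) : 1 <= k -> t `^ p <= (k * t) `^ p.
  by move=> k1; apply: powR_le => //; rewrite ler_peMl.
have e2t : e + e <= t.
  apply: le_trans et; rewrite ler_peMl ?addr_ge0//.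
  by rewrite -[leLHS](powRr0 (N.+2%:R)) ler_powR ?ler1n// invr_ge0 ltW.
move=> a s sa.
have [s1 [s2 [E h1 h2]]] := @sorted_split N (a :: s) sa.
case: s1 E h1 => [|a' s1] /=.
  move=> E _; apply: le_trans (tw _ _); last lra.
  by apply: Nt => /=; rewrite sa andbT; apply: h2; rewrite -E mem_head.
case=> <- {a'} sE h1; move: sa; rewrite sE cat_path => /andP[sa1 sa2].
rewrite pvar_cat.
have b1 : pvar p d a s1 <= t `^ p.
  rewrite -james_variation_leE//.
  (* Past the end [nth] returns the default 0, an index that is also at most N. *)
  have h (i : nat) : `|d (nth 0%N (a :: s1) i)| <= e.
    apply: hd; have [i1|i1] := ltnP i (size (a :: s1)); last by rewrite nth_default.
    by apply: h1; rewrite mem_nth.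
  apply: le_trans (james_variation_bound p1 e0 h) (le_trans _ et).
  rewrite ler_wpM2r ?addr_ge0//; apply: powR_le; rewrite ?invr_gt0//.
  rewrite ler_nat (@leq_trans N.+1)//.
  rewrite -[leqRHS](size_iota 0); apply: uniq_leq_size.
    exact: (sorted_uniq ltn_trans ltnn).
  by move=> k /h1; rewrite mem_iota /= add0n.
case: s2 sE h2 sa2 => [|b s3] sE h2 /=; first by rewrite addr0 (le_trans b1)// tw//; lra.
case/andP => lb s3b.
set c := last a s1 in lb *.
have cN : (c <= N)%N by apply: h1; rewrite mem_last.
have Nb : (N < b)%N by apply: h2; rewrite mem_head.
have b3 : pvar p d b s3 <= t `^ p by apply: Nt; rewrite /= Nb.
have b2 : `|d b - d c| <= 2 * t.
  have := tl [:: b]; rewrite /= Nb james_variation2// => /(_ isT) h.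
  have := hd _ (leqnn N); have := hd _ cN => k1 k2.
  (* The jump is routed through N, since the tail hypothesis concerns paths starting there. *)
  have -> : d b - d c = (d b - d N) + (d N - d c) by ring.
  apply: le_trans (ler_normD _ _) _; have := ler_normB (d N) (d c).
  move: (d N) (d c) (d b) h k1 k2 e2t => *; lra.
have := powR_superadditive p1' t0 t0.
have := @powR_superadditive _ p (2 * t) (t + t) p1'.
have := @powR_superadditive _ p (4 * t) t p1'.
have : `|d b - d c| `^ p <= (2 * t) `^ p.
  exact: powR_le p0 (normr_ge0 _) b2.
have -> : 2 * t + (t + t) = 4 * t by ring.
have -> : 4 * t + t = 5 * t by ring.
move=> k1 k2 k3 k4.
have {}k2 := k2 ltac:(lra) ltac:(lra).
have {}k3 := k3 ltac:(lra) ltac:(lra).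
by have := powR_ge0 t p; lra.
Qed.

(** All [w j] have small tails beyond a common N, and the pigeonhole principle provides two of them
    with close heads. *)
Lemma close_midpoints (n : nat) (v : james p1) (e : R) (w : nat -> james p1) :
  p <= n%:R -> v != 0 -> 0 < e -> 4 * e <= 1 ->
  (forall j, `|v + w j| <= (1 + e) * `|v| /\ `|v - w j| <= (1 + e) * `|v|) ->
  exists i j, i != j /\
    `|w i - w j| <= 20 * ((n%:R * (4 * e)) `^ p^-1 * `|v|).
Proof.
move=> pn v0 e0 e4 vw.
have [N hN] := tail_midpoint pn v0 e0 e4.
set t0 := _ `^ _ * ((1 + e) * `|v|) in hN.
have n0 : 0 < n%:R :> R by exact: lt_le_trans pn.
have D0 : 0 < `|v| by rewrite normr_gt0.
have P0 : 0 < (n%:R * (4 * e)) `^ p^-1.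
  by rewrite powR_gt0// !mulr_gt0.
have t00 : 0 < t0 by rewrite /t0 !mulr_gt0//; lra.
set c := N.+2%:R `^ p^-1 : R.
have c0 : 0 < c by rewrite powR_gt0.
have wb j k : `|w j k| <= (2 + e) * `|v|.
  apply: le_trans (ler_james _ _) _.
  have -> : w j = (v + w j) - v by rewrite addrC addKr.
  have -> : (2 + e) * `|v| = (1 + e) * `|v| + `|v| by ring.
  by apply: le_trans (ler_normB _ _) _; rewrite lerD2r (vw j).1.
(* The mesh [t0 / c] is what [james_norm_small_head] asks of the head when its bound is 2 [t0]. *)
have [i [j [ij h]]] := @pigeonhole_bounded N _ (t0 / c) (fun j => w j)
  (divr_gt0 t00 c0) wb.
exists i, j; split=> //.
(* 20 = 5 * 2 * 2: the factor 5 of [james_norm_small_head], a 2 for adding the tails of [w i] and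
   [w j], and a 2 bounding 1 + e. *)
have -> : 20 * ((n%:R * (4 * e)) `^ p^-1 * `|v|) =
  5 * (2 * (2 * ((n%:R * (4 * e)) `^ p^-1 * `|v|))) by ring.
have tt : t0 <= 2 * ((n%:R * (4 * e)) `^ p^-1 * `|v|).
  rewrite /t0 mulrCA ler_wpM2r//; last lra.
  by rewrite ltW// mulr_gt0.
apply: (@le_trans _ _ (5 * (2 * t0))); last lra.
apply: (@james_norm_small_head (w i - w j) N (t0 / c) _
  (divr_ge0 (ltW t00) (ltW c0)) (mulr_ge0 (ler0n _ 2) (ltW t00)) _ h).
  by rewrite -/c -mulr2n -mulrnAl mulrCA divff ?gt_eqF// mulr1 mulr_natl.
move=> s sN.
have -> : james_val (w i - w j) = w i \+ (fun n => - w j n) by [].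
apply: le_trans (james_variationD p1 _ _ _) _; rewrite james_variationN//.
rewrite mulr_natl mulr2n.
exact: lerD (hN _ (vw i).1 (vw i).2 _ sN) (hN _ (vw j).1 (vw j).2 _ sN).
Qed.

End midpoint_target.

(** * Separated approximate midpoints in the source *)

Section midpoint_source.
Context {R : realType} (p : R) (p1 : 1 < p).
Let p0 : 0 < p. Proof. exact: lt_trans p1. Qed.
Let p1' : 1 <= p. Proof. exact: ltW. Qed.

(** Along a path whose p-variation sum exceeds |u|^p - r^p, any continuation adds at most r^p,
    because the total is at most |u|^p. *)
Lemma small_tail (u : james p1) (r : R) : 0 < r ->
  exists N, forall s, path ltn N s -> james_variation p u (N :: s) <= r.
Proof.
move=> r0.
have rp0 : 0 < r `^ p by rewrite powR_gt0.
have [ur|ru] := leP (`|u| `^ p) (r `^ p).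
  exists 0%N => s ss; rewrite james_variation_leE ?(ltW r0)//.
  exact: le_trans (pvar_le u ss) ur.
have d0 : 0 <= `|u| `^ p - r `^ p by rewrite subr_ge0 ltW.
have [||a [s [sa us]]] := @james_norm_lt_pvar _ _ p1 u ((`|u| `^ p - r `^ p) `^ p^-1).
- exact: powR_ge0.
- rewrite ltNge; apply/negP => /(powR_le p0 (normr_ge0 u)).
  by rewrite powRVK// lerDl oppr_ge0 leNgt rp0.
rewrite powRVK// in us; exists (last a s) => t ts.
rewrite james_variation_leE ?(ltW r0)//.
have : pvar p u a (s ++ t) <= `|u| `^ p by apply: pvar_le; rewrite cat_path sa.
rewrite pvar_cat -lerBrDl => /le_trans; apply.
by rewrite lerBlDl -lerBlDr ltW.
Qed.

(* The bound on the coordinates of z controls the jump from the head of u to the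
   support of z; beyond that jump the p-th powers of the norms add up. *)
Lemma norm_perturbation (u : james p1) (d r : R) : 0 < d <= 1 -> 0 < r ->
  (4 * r) `^ p <= d / 2 * `|u| `^ p ->
  exists M, forall z : james p1, (forall n, (n <= M)%N -> z n = 0) ->
    (forall n, `|z n| <= d / 2 * `|u|) -> `|z| <= 3 * r ->
    `|u + z| <= (1 + d) * `|u|.
Proof.
move=> /andP[d0 d1] r0 ru.
have [M tl] := small_tail u r0; exists M => z zM zc zr.
have [d20 dd20 dd0] : [/\ 0 <= d / 2, 1 <= 1 + d / 2 & 0 <= 1 + d] by split; lra.
have K0 : 0 <= (1 + d) * `|u| by rewrite mulr_ge0.
(* The enlargement by d is shared: the factor 1 + d/2 pays for the head and the jump, the added d/2
   for the tail. *)
have big : (1 + d / 2) `^ p * `|u| `^ p + d / 2 * `|u| `^ p <= ((1 + d) * `|u|) `^ p.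
  rewrite [leRHS]powRM// -mulrDl ler_wpM2r ?powR_ge0//.
  apply: le_trans (powR_add_ge p1' dd20 d20) _.
  by rewrite -addrA -splitr.
have uP : 0 <= (1 + d / 2) `^ p * `|u| `^ p by rewrite mulr_ge0// powR_ge0.
apply: james_norm_le_pvar => // a s sa.
have -> : james_val (u + z) = u \+ z by [].
have tuz b t : path ltn M (b :: t) -> pvar p (u \+ z) b t <= d / 2 * `|u| `^ p.
  move=> bt'; have /andP[Mb bt] := bt'; apply: le_trans ru.
  rewrite -james_variation_leE ?mulr_ge0 ?(ltW r0)//.
  apply: le_trans (james_variationD p1 _ _ _) _.
  have -> : 4 * r = r + 3 * r by ring.
  apply: lerD; last by apply: le_trans zr; exact: ler_james_variation.
  (* Prepending M gives a path covered by [tl] and can only increase the variation. *)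
  apply: le_trans (tl _ bt').
  rewrite [leRHS]james_variationE//= james_variation_leE ?powR_ge0//.
  by rewrite powRVK ?lerDr ?addr_ge0 ?powR_ge0 ?pvar_ge0.
have [s1 [s2 [E h1 h2]]] := @sorted_split M (a :: s) sa.
case: s1 E h1 => [|a' s1] /=.
  move=> E _; apply: (@le_trans _ _ (d / 2 * `|u| `^ p)); last first.
    by apply: le_trans big; rewrite lerDr.
  by apply: tuz; rewrite /= sa andbT; apply: h2; rewrite -E mem_head.
case=> <- {a'} sE h1; move: sa; rewrite sE.
case: s2 sE h2 => [|b s3] sE h2.
  rewrite cats0 => sa; rewrite (@eq_pvar _ _ _ u); last first.
    by move=> n /h1 /zM /= zn; rewrite -[RHS]addr0 -zn.
  apply: le_trans (pvar_le u sa) _; rewrite powRM// ler_peMl ?powR_ge0//.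
  by rewrite -[leLHS](powRr0 (1 + d)) ler_powR ?(ltW p0)// lerDl ltW.
rewrite -cat_rcons cat_path pvar_cat last_rcons => /andP[sa1 sa2].
have Mb : (M < b)%N by apply: h2; rewrite mem_head.
apply: le_trans big; apply: lerD; last by apply: tuz; rewrite /= Mb.
rewrite -powRM//; last by apply: le_trans dd20.
rewrite -(james_variation_leE p1); last by rewrite mulr_ge0// (le_trans _ dd20).
apply: le_trans (james_variationD p1 _ _ _) _.
rewrite mulrDl mul1r; apply: lerD; first by apply: ler_james_variation.
rewrite (james_variation_leE p1); last by rewrite mulr_ge0.
rewrite -cats1 pvar_cat (@eq_pvar _ _ _ (fun=> 0)); last by move=> n /h1/zM.
rewrite pvar0// add0r /= addr0.
have -> : z (last a s1) = 0 by apply: zM; apply: h1; rewrite mem_last.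
by rewrite subr0; apply: powR_le.
Qed.

(* The parity condition makes consecutive values in the block [m, m + l) differ
   by exactly c, whatever m is. *)
Definition spikes (c : R) (m l n : nat) : R :=
  if ((m <= n < m + l) && odd n)%N then c else 0.

Lemma spikes_itv c m l n : 0 <= c -> 0 <= spikes c m l n <= c.
Proof. by move=> c0; rewrite /spikes; case: ifP; rewrite lexx c0. Qed.

Lemma spikes_bound c m l n : 0 <= c -> `|spikes c m l n| <= c.
Proof. by move=> /(spikes_itv m l n)/andP[s0 sc]; rewrite ger0_norm. Qed.

(** Only steps with an endpoint in [m, m + l) contribute, at most c^p each, and each of them lowers
    the truncated difference by at least one. Starting the count at [m.-1] allows for the step that
    enters the block. *)
Lemma pvar_spikes_le c m l a s : 0 <= c -> (0 < m)%N -> path ltn a s ->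
  pvar p (spikes c m l) a s <= c `^ p *+ (m + l - maxn a m.-1).
Proof.
move=> c0 m0; elim: s a => [|b s IH] a /=.
  by move=> _; rewrite mulrn_wge0// powR_ge0.
move=> /andP[ab sb]; apply: le_trans (lerD (lexx _) (IH _ sb)) _.
have step : `|spikes c m l b - spikes c m l a| `^ p <=
    c `^ p *+ ((m <= a < m + l) || (m <= b < m + l))%N.
  have [ml|/norP[nA nB]] := boolP (_ || _); last first.
    rewrite /spikes (negbTE nA) (negbTE nB) subrr normr0 powR0 ?gt_eqF//.
  apply: powR_le => //.
  have /andP[A0 A1] := spikes_itv m l a c0.
  have /andP[B0 B1] := spikes_itv m l b c0.
  by rewrite ler_norml; apply/andP; split; lra.
apply: le_trans (lerD step (lexx _)) _.
rewrite -mulrnDr; apply: ler_wpMn2l; first exact: powR_ge0.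
by case: (boolP (m <= a < m + l)%N); case: (boolP (m <= b < m + l)%N) => /=; lia.
Qed.

Lemma pvar_zigzag x c a l :
  (forall n, (a <= n < a + l)%N -> `|x n.+1 - x n| = c) ->
  pvar p x a (iota a.+1 l) = c `^ p *+ l.
Proof.
elim: l a => [|l IH] a xc //=.
rewrite xc ?leqnn ?addnS ?ltnS ?leq_addr// mulrS IH// => n /andP[an nl].
by apply: xc; rewrite (ltnW an) addnS -addSn.
Qed.

Lemma blocks_disjoint (k b i j n : nat) : i != j ->
  (b + k * i <= n < b + k * i + k)%N -> ~~ (b + k * j <= n < b + k * j + k)%N.
Proof.
by case: (ltngtP i j) => // /(leq_mul (leqnn k)); rewrite mulnS; lia.
Qed.

(** The [z j] are trains of spikes on disjoint blocks beyond the M of [norm_perturbation]. On block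
    i the difference [z i - z j] makes k jumps of size c with k c^p = r^p, so its norm is at least
    r, while each [z j] has norm at most 3r. *)
Lemma separated_midpoints (u : james p1) (d : R) : 0 < d <= 1 -> u != 0 ->
  exists z : nat -> james p1,
    (forall j, `|u + z j| <= (1 + d) * `|u| /\ `|u - z j| <= (1 + d) * `|u|) /\
    forall i j, i != j -> (d / 2) `^ p^-1 * `|u| / 4 <= `|z i - z j|.
Proof.
move=> d01 u0; have /andP[d0 d1] := d01.
have D0 : 0 < `|u| by rewrite normr_gt0.
have d20 : 0 < d / 2 by rewrite divr_gt0.
set r := (d / 2) `^ p^-1 * `|u| / 4.
have r0 : 0 < r by rewrite divr_gt0// mulr_gt0// powR_gt0.
have ru : (4 * r) `^ p <= d / 2 * `|u| `^ p.
  have -> : 4 * r = (d / 2) `^ p^-1 * `|u| by rewrite /r mulrC divfK.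
  by rewrite powRM ?powR_ge0// powRVK// ltW.
have [M hM] := norm_perturbation d01 r0 ru.
pose e := d / 2 * `|u|.
have e0 : 0 < e by rewrite mulr_gt0.
(* k is taken so large that spikes of height c = r / k^(1/p) respect the coordinate bound [e] of
   [norm_perturbation]. Blocks will have k + 1 points, hence k inner steps. *)
pose k := (Num.truncn ((r / e) `^ p)).+1.
have ke : (r / e) `^ p <= k%:R by rewrite ltW// truncnS_gt.
have k0 : 0 < k%:R :> R by rewrite ltr0n.
pose c := r / k%:R `^ p^-1.
have c0 : 0 < c by rewrite divr_gt0// powR_gt0.
have cE : c `^ p *+ k = r `^ p.
  rewrite -(mulr_natl (c `^ p)) -[in X in X * _](powRVK p0 (ltW k0)).
  by rewrite -powRM ?(ltW c0) ?powR_ge0// /c mulrC divfK// gt_eqF// powR_gt0.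
have ce : c <= e.
  rewrite /c ler_pdivrMr ?powR_gt0// mulrC -ler_pdivrMr//.
  rewrite -(powRKV p0 (ltW (divr_gt0 r0 e0))).
  by apply: powR_le; rewrite ?invr_gt0 ?powR_ge0.
have k1 : (0 < k)%N by [].
clearbody k; clear ke.
pose start j := (M.+1 + k.+1 * j)%N.
have start_gt0 j : (0 < start j)%N by [].
pose f j := spikes c (start j) k.+1.
have r30 : 0 <= 3 * r by rewrite mulr_ge0// ltW.
have fE j n : ~~ (start j <= n < start j + k.+1)%N -> f j n = 0.
  by rewrite /f /spikes => /negbTE ->.
have fle j a s : path ltn a s -> pvar p (f j) a s <= (3 * r) `^ p.
  move=> sa; apply: le_trans (pvar_spikes_le _ (ltW c0) (start_gt0 j) sa) _.
  rewrite powRM ?(ltW r0)// -cE.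
  (* At most k + 2 steps meet a block of k + 1 points, k + 2 <= 3k, and 3 <= 3^p. *)
  apply: (@le_trans _ _ (c `^ p *+ (3 * k))).
    apply: ler_wpMn2l; first exact: powR_ge0.
    have := start_gt0 j; move: (start j) (maxn _ _) (leq_maxr a (start j).-1) => m n.
    clear -k1; lia.
  rewrite mulnC mulrnA -(mulr_natl (_ *+ k)) ler_wpM2r ?mulrn_wge0 ?powR_ge0//.
  by rewrite -[leLHS](powRr1 (ler0n _ 3)) ler_powR// ler1n.
have fJ j : f j \in james_pred p1.
  apply/james_predP.
  apply: (@is_james_finite_support _ _ p1 (f j) (start j + k.+1) (3 * r)) => //; last exact: fle.
  by move=> n nj; apply: fE; rewrite negb_and -leqNgt nj orbT.
pose z j := James (fJ j).
have z0 j n : (n <= M)%N -> z j n = 0.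
  by move=> nM; apply: fE; rewrite negb_and -ltnNge /start addSn ltnS (leq_trans nM) ?leq_addr.
have zc j n : `|z j n| <= e by apply: le_trans ce; exact: spikes_bound (ltW c0).
have zr j : `|z j| <= 3 * r by apply: james_norm_le_pvar => // a s; exact: fle.
exists z; split=> [j|].
  split; first by apply: hM => //; exact: z0.
  apply: hM; last by rewrite normrN.
    by move=> n nM; rewrite -[LHS]/(- z j n) z0// oppr0.
  by move=> n; rewrite -[X in `|X|]/(- z j n) normrN.
move=> i j ij.
rewrite -[leLHS](powRKV p0 (ltW r0)).
rewrite (ler_powRV p0 (powR_ge0 _ _) (normr_ge0 _)) -cE.
rewrite -(@pvar_zigzag (z i - z j) c (start i) k).
  by apply: pvar_le; exact: (iota_ltn_sorted (start i) k.+1).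
have step n : (start i <= n < start i + k.+1)%N -> (z i - z j) n = if odd n then c else 0.
  move=> ni; rewrite -[LHS]/(f i n - f j n) [f j n]fE; last first.
    exact: blocks_disjoint ij ni.
  by rewrite subr0 /f /spikes ni.
move=> n /andP[n1 n2]; rewrite !step ?n1 ?(leqW n1) ?addnS ?ltnS ?(ltnW n2)//=.
by case: odd; rewrite ?sub0r ?subr0 ?normrN ger0_norm// ltW.
Qed.

End midpoint_source.

(** * Coarse Lipschitz maps and approximate midpoints in normed spaces *)

Section coarse_midpoint.
Context {R : realType}.

Lemma sub_half_midpoint (V : lmodType R) (x y z : V) :
  x - (2^-1 *: (x + y) + z) = 2^-1 *: (x - y) - z.
Proof.
rewrite opprD addrA; congr (_ - z); apply/eqP.
rewrite subr_eq -scalerDr addrACA addNr addr0 -mulr2n -(scaler_nat 2 x) scalerA.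
by rewrite mulVf ?pnatr_eq0// scale1r.
Qed.

Lemma half_midpoint_sub (V : lmodType R) (x y z : V) :
  (2^-1 *: (x + y) + z) - y = 2^-1 *: (x - y) + z.
Proof.
by rewrite -opprB [x + y]addrC sub_half_midpoint opprD opprK -scalerN opprB.
Qed.

Lemma norm_half (V : normedModType R) (x : V) : `|2^-1 *: x| = `|x| / 2.
Proof. by rewrite normrZ gtr0_norm ?invr_gt0// mulrC. Qed.

(** With L the asymptotic Lipschitz constant, (1 + d)L bounds the stretching at all large distances,
    while (1 - d)L is exceeded by pairs x, y arbitrarily far apart. For such a pair a midpoint
    cannot be sent much farther than half of |f x - f y| from either image. The multiples of v
    provide points at any prescribed distance, which forces L >= A > 0. *)
Lemma coarse_midpoints (V W : normedModType R) (f : V -> W) (theta A B d t : R)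
  (v : V) : 0 < A -> v != 0 ->
  (forall x y, theta <= `|x - y| ->
    A * `|x - y| <= `|f x - f y| <= B * `|x - y|) ->
  0 < d -> 4 * d <= 1 ->
  exists x y, t <= `|x - y| /\
    forall m, `|x - m| <= (1 + d) * (`|x - y| / 2) ->
      `|m - y| <= (1 + d) * (`|x - y| / 2) ->
      `|f x - f m| <= (1 + 6 * d) * (`|f x - f y| / 2) /\
      `|f m - f y| <= (1 + 6 * d) * (`|f x - f y| / 2).
Proof.
move=> A0 v0 fAB d0 d4.
(* [S] consists of the Lipschitz constants of [f] at large distances. *)
pose S : set R := [set l | exists s, forall x y, s <= `|x - y| ->
  `|f x - f y| <= l * `|x - y|]%classic.
have SB : S B by exists theta => x y /fAB/andP[].
have SA : lbound S A.
  move=> l [s sl].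
  pose D := Num.max theta (Num.max s 1).
  have [thD sD D1] : [/\ theta <= D, s <= D & 1 <= D].
    by rewrite /D !le_max !lexx !orbT.
  have D0 : 0 < D by exact: lt_le_trans D1.
  have E : `|(D / `|v|) *: v - 0| = D.
    by rewrite subr0 normrZ normrM normfV normr_id gtr0_norm// divfK// normr_eq0.
  have := sl ((D / `|v|) *: v) 0; have := fAB ((D / `|v|) *: v) 0.
  rewrite E => /(_ thD)/andP[h _] /(_ sD)/(le_trans h).
  by rewrite ler_pM2r.
pose L := inf S.
have AL : A <= L by apply: lb_le_inf => //; exists B.
have L0 : 0 < L by exact: lt_le_trans AL.
have infS : has_inf S by split; [exists B|exists A].
have [l [s sl] lL] : exists2 l, S l & l < (1 + d) * L.
  have [l Sl lL] := inf_adherent (mulr_gt0 d0 L0) infS.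
  by exists l => //; rewrite mulrDl mul1r.
have nS : ~ S ((1 - d) * L).
  move=> /(ge_inf infS.2); rewrite -/L; apply/negP; rewrite -ltNge.
  by rewrite gtr_pMl// gtrBl.
(* As d <= 1/4, a d-approximate midpoint of x, y is at distance at least |x - y| / 4 from both; the
   factor 4 thus makes the bound at distances beyond [s] applicable to it. *)
pose T := Num.max t (4 * Num.max s 0).
have [x [y [Txy xy]]] : exists x y, T <= `|x - y| /\ (1 - d) * L * `|x - y| < `|f x - f y|.
  apply: contrapT => h; apply: nS; exists T => x y Txy.
  by rewrite leNgt; apply/negP => xy; apply: h; exists x, y.
exists x, y; move: Txy; rewrite ge_max => /andP[txy sxy]; split => // m xm my.
have s0 : 0 <= Num.max s 0 by rewrite le_max lexx orbT.
have sxm : s <= Num.max s 0 by rewrite le_max lexx.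
have tri : `|x - y| <= `|x - m| + `|m - y|.
  by rewrite -[x - y](subrKA m) ler_normD.
have := sl x m; have := sl m y; have := normr_ge0 (x - m); have := normr_ge0 (m - y).
move: {sl SA SB fAB nS infS} (`|x - m|) (`|m - y|) (`|x - y|) (`|f x - f m|)
  (`|f m - f y|) (`|f x - f y|) (Num.max s 0) s0 sxm xm my tri sxy xy.
move=> a b D fa fb F s' s0 sxm xm my tri sxy xy b0 a0 hb ha.
have sa : s <= a by nra.
have sb : s <= b by nra.
have {}ha := ha sa; have {}hb := hb sb.
have D0 : 0 <= D by lra.
have key : (1 + d) * L * ((1 + d) * (D / 2)) <= (1 + 6 * d) * (F / 2).
  have : (1 + 6 * d) * ((1 - d) * L * D) <= (1 + 6 * d) * F by nra.
  have : 0 <= L * D by nra.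
  (* This determines the 6: the inequality amounts to 7 d^2 <= 3 d, which holds for d <= 1/4. *)
  have : (1 + d) * (1 + d) <= (1 + 6 * d) * (1 - d) by nra.
  nra.
have step c : 0 <= c -> c <= (1 + d) * (D / 2) -> l * c <= (1 + 6 * d) * (F / 2).
  move=> c0 cD; apply: le_trans (le_trans (ler_wpM2r c0 (ltW lL)) _) key.
  by rewrite ler_wpM2l// mulr_ge0 ?(ltW L0)// addr_ge0// ltW.
split; [exact: le_trans ha (step _ a0 xm)|exact: le_trans hb (step _ b0 my)].
Qed.

(** Two midpoints with close images are still c|u| apart, so the lower Lipschitz bound gives A c |u|
    <= c' |v|, and |v| <= B |u| by the upper bound for the pair x, y. *)
Lemma midpoint_separation (V W : normedModType R) (f : V -> W)
  (theta A B d c c' : R) (v0 : V) : v0 != 0 -> 0 < theta -> 0 < A ->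
  (forall x y, theta <= `|x - y| ->
    A * `|x - y| <= `|f x - f y| <= B * `|x - y|) ->
  0 < d -> 4 * d <= 1 -> 0 < c -> 0 < c' ->
  (forall u : V, u != 0 -> exists z : nat -> V,
    (forall j, `|u + z j| <= (1 + d) * `|u| /\ `|u - z j| <= (1 + d) * `|u|) /\
    forall i j, i != j -> c * `|u| <= `|z i - z j|) ->
  (forall (v : W) (w : nat -> W), v != 0 ->
    (forall j, `|v + w j| <= (1 + 6 * d) * `|v| /\
      `|v - w j| <= (1 + 6 * d) * `|v|) ->
    exists i j, i != j /\ `|w i - w j| <= c' * `|v|) ->
  A * c <= c' * B.
Proof.
move=> v0n th0 A0 fAB d0 d4 c0 c'0 sepV closeW.
(* The second threshold makes the separation c |x - y| / 2 of the midpoints at least [theta]. *)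
have [x [y [txy xy]]] := coarse_midpoints
  (Num.max theta (theta / (c / 2))) A0 v0n fAB d0 d4.
move: txy; rewrite ge_max => /andP[txy txy'].
pose u := 2^-1 *: (x - y).
have uE : `|u| = `|x - y| / 2 by exact: norm_half.
have D0 : 0 < `|x - y| by exact: lt_le_trans txy.
have un0 : u != 0 by rewrite -normr_gt0 uE divr_gt0.
pose v := 2^-1 *: (f x - f y).
have vE : `|v| = `|f x - f y| / 2 by exact: norm_half.
have /andP[fA fB] := fAB _ _ txy.
have vn0 : v != 0.
  by rewrite -normr_gt0 vE divr_gt0// (lt_le_trans _ fA)// mulr_gt0.
have [z [zu zs]] := sepV _ un0.
pose m j := 2^-1 *: (x + y) + z j.
pose w j := f (m j) - 2^-1 *: (f x + f y).
have fm j : `|f x - f (m j)| <= (1 + 6 * d) * `|v| /\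
    `|f (m j) - f y| <= (1 + 6 * d) * `|v|.
  rewrite vE; apply: xy; rewrite -uE.
    by rewrite sub_half_midpoint (zu j).2.
  by rewrite half_midpoint_sub (zu j).1.
have fmE j : f (m j) = 2^-1 *: (f x + f y) + w j by rewrite addrC subrK.
have vw j : `|v + w j| <= (1 + 6 * d) * `|v| /\ `|v - w j| <= (1 + 6 * d) * `|v|.
  have := fm j; rewrite fmE sub_half_midpoint half_midpoint_sub => -[h1 h2].
  by split.
have [i [j [ij wij]]] := closeW _ w vn0 vw.
have mE : m i - m j = z i - z j by rewrite /m opprD addrACA subrr add0r.
have wE : w i - w j = f (m i) - f (m j).
  by rewrite /w opprB addrA subrK.
have zij := zs _ _ ij.
have far : theta <= `|m i - m j|.
  rewrite mE; apply: le_trans zij; move: txy'.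
  rewrite uE ler_pdivrMr ?divr_gt0// => h; apply: le_trans h _.
  by rewrite (_ : `|x - y| * (c / 2) = c * (`|x - y| / 2))//; ring.
have /andP[fm1 _] := fAB _ _ far.
rewrite -wE mE in fm1.
have u0 : 0 < `|u| by rewrite normr_gt0.
rewrite -(ler_pM2r u0).
apply: (@le_trans _ _ (A * `|z i - z j|)); first by rewrite -mulrA ler_pM2l.
apply: le_trans fm1 (le_trans wij _).
by rewrite -mulrA ler_pM2l// vE uE mulrA ler_pM2r.
Qed.

End coarse_midpoint.

(** * Choice of the parameters and the contradiction *)

Lemma james_nontrivial (R : realType) (q : R) (q1 : 1 < q) : exists v : james q1, v != 0.
Proof.
have q0 : 0 < q by exact: lt_trans q1.
have fJ : spikes 1 1 1 \in james_pred q1.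
  apply/james_predP; apply: (@is_james_finite_support _ _ q1 _ 2 (2 `^ q^-1)).
  - exact: powR_ge0.
  - by move=> n n2; rewrite /spikes addn1 [(n < 2)%N]ltnNge n2 andbF.
  - move=> a s sa; apply: le_trans (pvar_spikes_le q1 _ ler01 _ sa) _ => //.
    by rewrite powRVK// powR1 ler_nat; lia.
exists (James fJ); apply/negP => /eqP/(congr1 (fun v : james q1 => v 1%N)) h.
have : spikes 1 1 1 1 = 0 :> R := h.
by move/eqP; rewrite /spikes /= oner_eq0.
Qed.

Theorem corollary3p3 (R : realType) (p q : R)
  (p1 : 1 < p) (q1 : 1 < q) (pq : p < q) :
  ~ coarse_lipschitz_embeds (james q1) (james p1).
Proof.
have p0 : 0 < p by exact: lt_trans p1.
have q0 : 0 < q by exact: lt_trans q1.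
move=> [f [theta [A [B [th0 A0 B0 fAB]]]]].
have {}fAB x y : theta <= `|x - y| ->
    A * `|x - y| <= `|f x - f y| <= B * `|x - y|.
  by move=> h; have := fAB x y; rewrite !james_mdistE; apply.
(* An integer exponent above p for the Bernoulli estimate. *)
pose n := (Num.truncn p).+1.
have pn : p <= n%:R by rewrite ltW// truncnS_gt.
have n0 : 0 < n%:R :> R by rewrite ltr0n.
pose al := p^-1 - q^-1.
have al0 : 0 < al by rewrite subr_gt0 ltf_pV2.
(* With d = 2 [eta], the inequality A (d/2)^(1/q) / 4 <= 20 (24 n d)^(1/p) B reads A <= K eta^(1/p -
   1/q). *)
pose K := 80 * ((48 * n%:R) `^ p^-1 * B).
have K0 : 0 < K by rewrite !mulr_gt0// powR_gt0// mulr_gt0.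
pose c := A / (2 * K).
have c0 : 0 < c by rewrite divr_gt0// mulr_gt0.
(* The bound 1/48 makes 6d an admissible midpoint error in the target; the other one gives K eta^al
   <= A/2, contradicting A <= K eta^al. *)
pose eta := Num.min (48^-1) (c `^ al^-1).
have eta0 : 0 < eta by rewrite lt_min invr_gt0 powR_gt0// ltr0n.
have etac : eta `^ al <= c.
  apply: (@le_trans _ _ ((c `^ al^-1) `^ al)); last by rewrite powRVK// ltW.
  by apply: powR_le => //; [exact: ltW|rewrite ge_min lexx orbT].
have eta48 : eta <= 48^-1 by rewrite ge_min lexx.
have d0 : 0 < 2 * eta by rewrite mulr_gt0.
have d24 : 24 * (2 * eta) <= 1 by lra.
have [v0 v0n] := james_nontrivial q1.
have [d4 d1 d60 d61] : [/\ 4 * (2 * eta) <= 1, 0 < 2 * eta <= 1,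
    0 < 6 * (2 * eta) & 4 * (6 * (2 * eta)) <= 1] by split; lra.
set d := 2 * eta in d0 d24 d4 d1 d60 d61.
have c10 : 0 < (d / 2) `^ q^-1 / 4 by rewrite divr_gt0// powR_gt0// divr_gt0.
have c20 : 0 < 20 * (n%:R * (4 * (6 * d))) `^ p^-1.
  by rewrite mulr_gt0// powR_gt0// !mulr_gt0.
have : A * ((d / 2) `^ q^-1 / 4) <= 20 * (n%:R * (4 * (6 * d))) `^ p^-1 * B.
  apply: (midpoint_separation v0n th0 A0 fAB d0 d4 c10 c20) => [u u0|v w v0' vw].
    have [z [zu zs]] := separated_midpoints d1 u0.
    by exists z; split => // i j ij; rewrite mulrAC; exact: zs.
  have [i [j [ij wij]]] := close_midpoints pn v0' d60 d61 vw.
  by exists i, j; split => //; rewrite -mulrA.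
rewrite /d.
have -> : 2 * eta / 2 = eta by field.
have -> : n%:R * (4 * (6 * (2 * eta))) = 48 * n%:R * eta by ring.
have -> : (48 * n%:R * eta) `^ p^-1 = (48 * n%:R) `^ p^-1 * (eta `^ al * eta `^ q^-1).
  rewrite [LHS]powRM ?mulr_ge0 ?(ltW eta0)// -powRD; first by rewrite subrK.
  by rewrite (gt_eqF eta0) implybT.
apply/negP; rewrite -ltNge.
have E0 : 0 < eta `^ q^-1 by rewrite powR_gt0.
have KA : K * eta `^ al < A.
  apply: (@le_lt_trans _ _ (K * c)); first by rewrite ler_pM2l.
  have -> : K * c = A / 2 by rewrite /c; field; rewrite gt_eqF.
  lra.
have -> : 20 * ((48 * n%:R) `^ p^-1 * (eta `^ al * eta `^ q^-1)) * B =
  K * eta `^ al * (eta `^ q^-1 / 4) by rewrite /K; field.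
by rewrite ltr_pM2r// divr_gt0.
Qed.
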